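(* Let $G$ be a transient graph, i.e. a connected rooted graph of bounded degree on which simple random walk is transient. For $a>0$ let $\mathbf X$ be the once-reinforced random walk ORRW($a$) on $G$ started at the root $0$, with expectation $\mathbb E^{(a)}$, and let $S$ be the first return time to the starting point, $S:=\inf\{n\ge1: X_{\tau_n}=0\}\in\mathbb N\cup\{\infty\}$. Then $$\limsup_{a\uparrow1}\ \mathbb E^{(a)}[S]=\infty.$$
   Context: ORRW($a$): the right-continuous nearest-neighbour continuous-time process $(X_t)_{t\ge0}$ on the vertices of $G$ with $X_0=0$ such that, with $\mathfrak C_t$ the set of (unoriented) edges traversed by time $t$ and $\mathcal F_t=\sigma(X_s:s\le t)$, on $\{X_t=i\}$ and for every neighbour $j$ of $i$, $\mathbb P(X_{t+h}=j\mid\mathcal F_t)=h\mathbf 1_{\{\{i,j\}\in\mathfrak C_t\}}+a h\mathbf 1_{\{\{i,j\}\notin\mathfrak C_t\}}+o(h)$, and the probability of more than one jump in $(t,t+h)$ is $o(h)$. $\tau_0=0$ and $\tau_n=\inf\{t>\tau_{n-1}:X_t\ne X_{\tau_{n-1}}\}$ are the jump times. Simple random walk is the case $a=1$. *)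

(* Defs.v *)
From HB Require Import structures.
From mathcomp Require Import all_boot all_order all_algebra.
From mathcomp Require Import all_classical all_reals all_analysis.
Set Implicit Arguments.
Unset Strict Implicit.
Unset Printing Implicit Defensive.
Import Order.TTheory GRing.Theory Num.Theory.
Import numFieldNormedType.Exports.
Local Open Scope classical_set_scope.
Local Open Scope ring_scope.

Definition connected_graph (V : Type) (e : rel V) : Prop :=
  forall x y, exists2 p : seq V, path e x p & last x p = y.

Definition bounded_degree (V : Type) (e : rel V) : Prop :=
  exists D : nat, forall x, ([set y | e x y] #<= `I_D)%card.

(* A process in continuous time is a map X : R -> T -> V, of which only the
   values X t with 0 <= t are ever used. *)

(* The clause t > tau_n makes the set empty, hence tau_n+1 = +oo, as soon as
   tau_n = +oo; the value of fine at +oo is therefore irrelevant. *)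
Fixpoint jump_time (R : realType) (T V : Type) (X : R -> T -> V) (n : nat)
    (w : T) : \bar R :=
  if n is m.+1 then
    let tau := jump_time X m w in
    ereal_inf [set t%:E | t in
      [set t : R | (tau < t%:E)%E /\ X t w <> X (fine tau) w]]
  else 0%E.

(* X at the n-th jump time; meaningful only when that time is finite. *)
Definition jump_chain (R : realType) (T V : Type) (X : R -> T -> V) (n : nat)
    (w : T) : V :=
  X (fine (jump_time X n w)) w.

Definition return_time (R : realType) (T V : Type) (o : V) (X : R -> T -> V)
    (w : T) : \bar R :=
  ereal_inf [set n%:R%:E | n in
    [set n : nat | [/\ (1 <= n)%N, (jump_time X n w < +oo)%E &
                       jump_chain X n w = o]]].

Definition traversed (R : realType) (T V : Type) (X : R -> T -> V) (t : R)
    (i j : V) : set T :=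
  [set w | exists n, (jump_time X n.+1 w <= t%:E)%E /\
     ((jump_chain X n w = i /\ jump_chain X n.+1 w = j) \/
      (jump_chain X n w = j /\ jump_chain X n.+1 w = i))].

(* The index n = 0 never contributes when 0 <= t, since tau_0 = 0. *)
Definition multiple_jumps (R : realType) (T V : Type) (X : R -> T -> V)
    (t h : R) : set T :=
  [set w | exists n, (t%:E < jump_time X n w)%E /\
                     (jump_time X n.+1 w < (t + h)%:E)%E].

(* V carries the discrete sigma-algebra. *)
Definition natural_filtration (R : realType) (T V : Type) (X : R -> T -> V)
    (t : R) : set (set T) :=
  <<s [set A | exists s (B : set V), 0 <= s <= t /\ A = X s @^-1` B] >>.

(* Z is a version of the conditional probability of B given the
   sub-sigma-algebra F. *)
Definition is_cond_prob (R : realType) (d : measure_display)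
    (T : measurableType d) (P : probability T R) (F : set (set T))
    (B : set T) (Z : T -> R) : Prop :=
  [/\ forall U : set R, measurable U -> F (Z @^-1` U),
      P.-integrable setT (EFin \o Z) &
      forall A, F A -> (\int[P]_(w in A) (Z w)%:E = P (A `&` B))%E].

Definition is_little_oh (R : realType) (eps : R -> R) : Prop :=
  eps h / h @[h --> 0^'+] --> (0 : R).

(* The error terms o(h) are deterministic and uniform in the time t.  Were
   they allowed to depend on t, the two infinitesimal conditions would not
   determine the law of X: a jump added at a fixed deterministic time would
   be invisible to them. *)
Record orrw (R : realType) (V : choiceType) (e : rel V) (o : V) (a : R)
    (d : measure_display) (T : measurableType d) (P : probability T R)
    (X : R -> T -> V) : Prop := {
  orrw_measurable : forall (t : R) (B : set V),
    0 <= t -> measurable (X t @^-1` B);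
  orrw_start : forall w, X 0 w = o;
  orrw_right_continuous : forall w (t : R),
    0 <= t -> \forall s \near t^'+, X s w = X t w;
  orrw_nearest_neighbour : forall w n, (jump_time X n.+1 w < +oo)%E ->
    e (jump_chain X n w) (jump_chain X n.+1 w);
  orrw_jump_rate : forall i j, e i j ->
    exists2 eps : R -> R, is_little_oh eps &
    forall t h : R, 0 <= t -> 0 < h ->
    exists2 Z : T -> R,
      is_cond_prob P (natural_filtration X t) [set w | X (t + h) w = j] Z &
      {ae P, forall w, X t w = i ->
        `|Z w - (h * \1_(traversed X t i j) w
                 + a * h * \1_(~` traversed X t i j) w)| <= eps h};
  orrw_multiple_jumps :
    exists2 eps : R -> R, is_little_oh eps &
    forall t h : R, 0 <= t -> 0 < h ->
      (P (multiple_jumps X t h) <= (eps h)%:E)%E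
}.

(* Simple random walk is once-reinforced random walk with a = 1; it is
   transient when its probability of ever returning to o is less than 1. *)
Definition transient (R : realType) (V : choiceType) (e : rel V) (o : V) :
    Prop :=
  exists (d : measure_display) (T : measurableType d) (P : probability T R)
    (X : R -> T -> V),
    orrw e o 1 P X /\ (P [set w | (return_time o X w < +oo)%E] < 1)%E.

(* Main.v *)
(* Let C(g) be the event that the jump chain begins with the path g.  For two
   neighbours i, j of the endpoint of g, the probabilities of having followed
   g.i, respectively g.j, by time t both grow at rate w * P(currently at g),
   where w is the weight of the edge used; cross-multiplied by the weights, their
   difference has increments o(h) uniformly in t, hence vanishes, and
   w_i P(C(g.j)) = w_j P(C(g.i)).  For a <= 1 this gives
   a deg P(C(g.j)) <= P(C(g)); for a = 1 the walk a.s. never stops, so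
   deg P(C(g.j)) = P(C(g)).  Summing over first-return paths of length at most k,
   P^(a)(S <= k) <= a^-k P^(1)(S <= k) <= a^-k q, with q < 1 the return
   probability of simple random walk.  Hence E^(a)[S] >= (k+1)(1 - a^-k q), which
   tends to (k+1)(1 - q) as a tends to 1. *)

Require Import Defs.
From mathcomp Require Import all_boot all_order all_algebra.
From mathcomp Require Import all_classical all_reals all_analysis.
From mathcomp Require Import measurable_realfun ring lra.
Set Implicit Arguments.
Unset Strict Implicit.
Unset Printing Implicit Defensive.
Import Order.TTheory GRing.Theory Num.Theory.
Import numFieldNormedType.Exports.
Local Open Scope classical_set_scope.
Local Open Scope ring_scope.

(** * Jump times of a right-continuous path *)
Section paths.
Variables (R : realType) (T : Type) (V : choiceType) (X : R -> T -> V) (w : T).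
Hypothesis X_rc : forall t : R, 0 <= t -> \forall s \near t^'+, X s w = X t w.
Local Notation tau n := (jump_time X n w).
Local Notation chain n := (jump_chain X n w).

Lemma rc_segment (u : R) : 0 <= u ->
  exists2 r : R, 0 < r & forall s, u <= s < u + r -> X s w = X u w.
Proof.
move=> /X_rc; rewrite /at_right /within /= => /nbhs_ballP[r /= r0 H].
exists r => // s /andP[]; rewrite le_eqVlt => /predU1P[->//|us sur].
apply: H => //; rewrite /ball/= ltr_norml; apply/andP; split; lra.
Qed.

Lemma jump_time_ge0 n : (0 <= tau n)%E.
Proof.
elim: n => [//|n IH] /=; apply: le_ereal_inf_tmp => _ [t [tt _] <-].
by rewrite (le_trans IH)// ltW.
Qed.

Lemma jump_time_fin n : (tau n < +oo)%E -> exists2 u : R, 0 <= u & tau n = u%:E.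
Proof.
by have := jump_time_ge0 n; case: (tau n) => [r||]//; rewrite lee_fin; exists r.
Qed.

Lemma jump_time_le n (s : R) :
  (tau n < s%:E)%E -> X s w <> chain n -> (tau n.+1 <= s%:E)%E.
Proof. by move=> ts xs /=; apply: ereal_inf_lbound; exists s. Qed.

Lemma jump_chain_const n (s : R) :
  (tau n <= s%:E)%E -> (s%:E < tau n.+1)%E -> X s w = chain n.
Proof.
rewrite le_eqVlt => /predU1P[ts _|ts st]; first by rewrite /jump_chain ts.
by apply: contrapT => xs; have := jump_time_le ts xs; rewrite leNgt st.
Qed.

Lemma jump_timeS_ltyP n : (tau n.+1 < +oo)%E -> (tau n < +oo)%E.
Proof.
by move=> /= /ereal_inf_lt[_ [t [tt _] <-] _]; rewrite (lt_trans tt)// ltry.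
Qed.

Lemma jump_time_lt n : (tau n < +oo)%E -> (tau n < tau n.+1)%E.
Proof.
move=> /jump_time_fin[u u0 E]; have [r r0 H] := rc_segment u0.
apply: (@lt_le_trans _ _ (u + r)%:E); first by rewrite E lte_fin; lra.
rewrite /=; rewrite E; apply: le_ereal_inf_tmp => _ [t [ut xt] <-].
rewrite lee_fin leNgt; apply/negP => tur; apply: xt; apply: H.
by rewrite tur andbT; move: ut; rewrite lte_fin; apply: ltW.
Qed.

Lemma jump_time_leS n : (tau n <= tau n.+1)%E.
Proof.
have [|] := ltP (tau n) +oo%E; first by move/jump_time_lt/ltW.
rewrite leye_eq => /eqP E; rewrite leNgt; apply/negP; rewrite E => /jump_timeS_ltyP.
by rewrite E ltxx.
Qed.

Lemma jump_time_mono m n : (m <= n)%N -> (tau m <= tau n)%E.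
Proof.
elim: n => [|n IH]; first by rewrite leqn0 => /eqP->.
by rewrite leq_eqVlt => /predU1P[->//|/IH /le_trans]; apply; exact: jump_time_leS.
Qed.

(** Otherwise right-continuity would keep the path at [chain n] on a whole segment after [tau n.+1],
    and the infimum defining [tau n.+1] would be at least [r] larger. *)
Lemma jump_chain_neq n : (tau n.+1 < +oo)%E -> chain n.+1 <> chain n.
Proof.
move=> tS; have tn := jump_timeS_ltyP tS; have tlt := jump_time_lt tn.
have [v v0 E] := jump_time_fin tS; have [r r0 H] := rc_segment v0.
rewrite {1}/jump_chain E /= => xv.
suff : ((v + r)%:E <= v%:E)%E by rewrite lee_fin; lra.
rewrite -[leRHS]E /=; apply: le_ereal_inf_tmp => y [t [tt xt] <-].
rewrite lee_fin leNgt; apply/negP => tur; apply: (xt); rewrite -[RHS]xv; apply: H.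
by rewrite tur andbT -lee_fin -E; exact: jump_time_le tt xt.
Qed.

(** Holding intervals have positive length, so each contains a rational, even when cut off at [t].
    This reduces path events to countably many times. *)
Lemma rat_in_holding n (t : R) : (tau n < t%:E)%E ->
  exists q : rat, [/\ (tau n < (ratr q : R)%:E)%E, ratr q < t,
    ((ratr q : R)%:E < tau n.+1)%E & X (ratr q) w = chain n].
Proof.
move=> tt; have tn : (tau n < +oo)%E by rewrite (lt_trans tt)// ltry.
have tlt := jump_time_lt tn; have [u u0 E] := jump_time_fin tn.
have [t' [ut' t't t'S]] : exists t' : R, [/\ u < t', t' <= t & (t'%:E <= tau n.+1)%E].
  have [tS|tS] := leP t%:E (tau n.+1); first by exists t; rewrite -lte_fin -E.
  have [v v0 Ev] : exists2 v : R, 0 <= v & tau n.+1 = v%:E.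
    by apply: jump_time_fin; rewrite (lt_trans tS)// ltry.
  exists v; rewrite -lte_fin -E -Ev; split=> //.
  by rewrite -lee_fin -Ev ltW.
have [q] := rat_in_itvoo ut'; rewrite in_itv/= => /andP[uq qt].
have qS : ((ratr q : R)%:E < tau n.+1)%E by rewrite (lt_le_trans _ t'S)// lte_fin.
exists q; split=> //.
- by rewrite E lte_fin.
- exact: lt_le_trans t't.
- by apply: jump_chain_const => //; rewrite E lee_fin ltW.
Qed.

End paths.

(* The latest vertex comes first. *)
Fixpoint history (R : realType) (T V : Type) (X : R -> T -> V) (n : nat) (w : T)
    : seq V :=
  jump_chain X n w :: if n is m.+1 then history X m w else [::].

(** A list of k vertices records k - 1 jumps, hence the [.-1]. Histories are never empty, so the
    event is empty for [g = [::]]. This is the event C(g) of the outline. *)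
Definition follows (R : realType) (T V : Type) (X : R -> T -> V) (g : seq V)
    : set T :=
  [set w | (jump_time X (size g).-1 w < +oo)%E /\ history X (size g).-1 w = g].

Definition followed_by (R : realType) (T V : Type) (X : R -> T -> V)
    (g : seq V) (t : R) : set T :=
  [set w | (jump_time X (size g).-1 w <= t%:E)%E /\ history X (size g).-1 w = g].

(** The state of being currently at [g]; [size g] is the index of the next jump. *)
Definition history_at (R : realType) (T V : Type) (X : R -> T -> V)
    (g : seq V) (t : R) : set T :=
  followed_by X g t `&` [set w | (t%:E < jump_time X (size g) w)%E].

(* Right-continuous paths are determined on [0, t] by the rationals together
   with the endpoint t, here encoded as None. *)
Definition sample_time (R : realType) (t : R) (q : option rat) : R :=
  if q is Some q' then ratr q' else t.

(** * Path events as countable conditions on sampled positions *)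

Section history_paths.
Variables (R : realType) (T : Type) (V : choiceType) (X : R -> T -> V) (w : T).
Hypothesis X_rc : forall t : R, 0 <= t -> \forall s \near t^'+, X s w = X t w.
Local Notation tau n := (jump_time X n w).
Local Notation chain n := (jump_chain X n w).

(** The vertex reached by a first jump before [t] shows at some rational time before [t]; if the
    jump falls exactly at [t], the sample [None] sees it. *)
Lemma history_at1 (x : V) (t : R) : 0 <= t -> X 0 w = x ->
  history_at X [:: x] t w <->
  forall r, 0 <= sample_time t r <= t -> X (sample_time t r) w = x.
Proof.
move=> t0 X0; have c0 : chain 0 = x by rewrite /jump_chain.
split=> [[[_ _] tS] r /andP[r0 rt]|H].
  by rewrite -c0; apply: jump_chain_const => //; rewrite (le_lt_trans _ tS)// lee_fin.
split; first by split; rewrite /= ?c0// lee_fin.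
rewrite /= ltNge; apply/negP => tS.
have tSy : (tau 1%N < +oo)%E by rewrite (le_lt_trans tS)// ltry.
have [v v0 Ev] := jump_time_fin tSy; have := jump_chain_neq X_rc tSy; rewrite c0; apply.
move: tS; rewrite -/(jump_time X 1%N w) le_eqVlt => /predU1P[E|tS].
  by rewrite /jump_chain E; apply: (H None); rewrite /= lexx t0.
have [q [vq qt _ <-]] := rat_in_holding X_rc tS.
apply: (H (Some q)) => /=; rewrite (ltW qt) andbT -lee_fin.
by rewrite (le_trans _ (ltW vq))// jump_time_ge0.
Qed.

(** Recursion on the history through sampled times: at a rational [q] the walk is at [x :: p], and
    from [q] on the samples show [x] and then [j] for good. The last clause excludes both a detour
    between [x] and [j] and a second jump by [t]. *)
Lemma history_at_cons (j x : V) (p : seq V) (t : R) : 0 <= t -> j <> x ->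
  history_at X (j :: x :: p) t w <->
  X t w = j /\ exists q : rat, [/\ 0 <= (ratr q : R) < t, history_at X (x :: p) (ratr q) w &
    forall r, (ratr q : R) <= sample_time t r <= t -> X (sample_time t r) w = x \/
      forall r', sample_time t r <= sample_time t r' <= t ->
        X (sample_time t r') w = j].
Proof.
move=> t0 jx; set n := size p.
split=> [[[/= t1 h] t2]|[Xt [q [/andP[q0 qt] [[/= tq hq] qS] H]]]].
  case: h => cj hx.
  have cx : chain n = x by move: hx; rewrite /n; case: (size p) => [|m] /= [].
  have Xt : X t w = j by rewrite -cj; exact: jump_chain_const.
  have tSy : (tau n.+1 < +oo)%E by rewrite (le_lt_trans t1)// ltry.
  have tlt := jump_time_lt X_rc (jump_timeS_ltyP tSy).
  have [q [uq qt qS Xq]] := rat_in_holding X_rc (lt_le_trans tlt t1).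
  split=> //; exists q; split.
  - by rewrite qt andbT -lee_fin (le_trans _ (ltW uq))// jump_time_ge0.
  - by split => //; split => //; exact: ltW.
  - move=> r /andP[qr rt]; have [rS|Sr] := ltP (sample_time t r)%:E (tau n.+1).
      by left; rewrite -cx; apply: jump_chain_const => //; rewrite (le_trans (ltW uq)).
    right=> r' /andP[rr' r't]; rewrite -cj; apply: jump_chain_const.
      by rewrite (le_trans Sr).
    by rewrite (le_lt_trans _ t2)// lee_fin.
have cx : chain n = x by move: hq; rewrite /n; case: (size p) => [|m] /= [].
have t1 : (tau n.+1 <= t%:E)%E.
  apply: jump_time_le; first by rewrite (le_lt_trans tq)// lte_fin.
  by rewrite Xt cx.
have tSy : (tau n.+1 < +oo)%E by rewrite (le_lt_trans t1)// ltry.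
have cS := jump_chain_neq X_rc tSy.
have [E|t1'] := eqVneq (tau n.+1) t%:E.
  have cj : chain n.+1 = j by rewrite /jump_chain E.
  split; first by split => //=; rewrite cj hq.
  by have := jump_time_lt X_rc tSy; rewrite E.
have {}t1' : (tau n.+1 < t%:E)%E by rewrite lt_neqAle t1' t1.
(* [r] lies in the holding interval after jump [n.+1]. The position there is not [x], so the second
   alternative holds and every sample from [r] to [t] shows [j]. *)
have [r [ur rt rS Xr]] := rat_in_holding X_rc t1'.
have qr : ratr q <= ratr r :> R by rewrite -lee_fin (le_trans (ltW qS))// ltW.
have Hr : forall r', ratr r <= sample_time t r' <= t -> X (sample_time t r') w = j.
  have [E|//] := H (Some r) (introT andP (conj qr (ltW rt))).
  by exfalso; apply: cS; rewrite -Xr E cx.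
have cj : chain n.+1 = j by rewrite -Xr; apply: (Hr (Some r)); rewrite /= lexx ltW.
split; first by split => //=; rewrite cj hq.
(* A further jump by [t] would leave [j], which would show at [t] or at a rational before it. *)
rewrite /= ltNge; apply/negP; rewrite -/(jump_time X n.+2 w) => t3.
have t3y : (tau n.+2 < +oo)%E by rewrite (le_lt_trans t3)// ltry.
have cSS := jump_chain_neq X_rc t3y.
have [E|t3'] := eqVneq (tau n.+2) t%:E.
  by apply: cSS; rewrite cj /jump_chain E.
have {}t3' : (tau n.+2 < t%:E)%E by rewrite lt_neqAle t3' t3.
have [s [us st sS Xs]] := rat_in_holding X_rc t3'.
apply: cSS; rewrite cj -Xs; apply: (Hr (Some s)).
by rewrite /= (ltW st) andbT -lee_fin (le_trans (ltW rS))// ltW.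
Qed.

Lemma followed_by_sample (g : seq V) (t : R) : 0 <= t ->
  followed_by X g t w <-> exists2 q, 0 <= sample_time t q <= t &
    history_at X g (sample_time t q) w.
Proof.
move=> t0; split=> [[tt h]|[q /andP[q0 qt] [[tq h] _]]]; last first.
  by split=> //; rewrite (le_trans tq)// lee_fin.
case: g => [|x p] in tt h *; first by [].
set n := (size (x :: p)).-1; move: tt; rewrite le_eqVlt => /predU1P[E|tt].
  exists None; rewrite /= ?lexx ?t0//; split; first by split=> //; rewrite -/n E.
  rewrite /= -E; apply: jump_time_lt => //.
  by rewrite E ltry.
have [q [uq qt qS _]] := rat_in_holding X_rc tt.
exists (Some q) => /=.
  by rewrite (ltW qt) andbT -lee_fin (le_trans _ (ltW uq))// jump_time_ge0.
by split=> //; split => //; rewrite ltW.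
Qed.

End history_paths.

(** * Measurability of the path events *)

Section countable_operations.
Variables (d : measure_display) (T : measurableType d) (I : countType).

Lemma bigcup_countType_measurable (D : set I) (F : I -> set T) :
  (forall i, D i -> measurable (F i)) -> measurable (\bigcup_(i in D) F i).
Proof.
move=> mF; rewrite bigcup_mkcond; apply: countable_bigcupT_measurable => // i.
by case: ifPn => // /set_mem; exact: mF.
Qed.

Lemma bigcap_countType_measurable (D : set I) (F : I -> set T) :
  (forall i, D i -> measurable (F i)) -> measurable (\bigcap_(i in D) F i).
Proof.
move=> mF; rewrite -[X in measurable X]setCK setC_bigcap; apply: measurableC.
by apply: bigcup_countType_measurable => i Di; apply: measurableC; exact: mF.
Qed.

End countable_operations.

Section history_measurable.
Variables (R : realType) (V : choiceType) (d : measure_display).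
Variables (T : measurableType d) (X : R -> T -> V) (o : V) (t : R).
Hypothesis X_rc : forall w (t : R), 0 <= t -> \forall s \near t^'+, X s w = X t w.
Hypothesis X_start : forall w, X 0 w = o.
Hypothesis mX : forall (s : R) (B : set V), 0 <= s <= t -> measurable (X s @^-1` B).

(** Induction on [g] via the sampled descriptions. The sigma-algebra of [T] is arbitrary and [mX]
    concerns only times up to [t], so that the result can also be read inside the natural
    filtration. *)
Lemma history_at_measurable (g : seq V) (s : R) :
  0 <= s <= t -> measurable (history_at X g s).
Proof.
elim: g s => [|j [|x p] IH] s /[dup] st /andP[s0 le_st].
- by rewrite [X in measurable X](_ : _ = set0)//; apply/seteqP; split=> // w [[]].
- have [->|/eqP jo] := eqVneq j o; last first.
    rewrite [X in measurable X](_ : _ = set0)//; apply/seteqP; split=> // w [[_]] /= [E] _.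
    by apply: jo; rewrite -E /jump_chain /= X_start.
  rewrite [X in measurable X](_ : _ = \bigcap_(r in [set r | 0 <= sample_time s r <= s])
      X (sample_time s r) @^-1` [set o]); last first.
    by apply/seteqP; split=> w; rewrite (history_at1 (X_rc w)).
  apply: bigcap_countType_measurable => r /= /andP[r0 rs].
  by apply: mX; rewrite r0 (le_trans rs).
have [->|/eqP jx] := eqVneq j x.
  rewrite [X in measurable X](_ : _ = set0)//; apply/seteqP; split=> // w [[t1]] /= [cj h _].
  have cx : jump_chain X (size p) w = x by move: h; case: (size p) => [|m] /= [].
  have : (jump_time X (size p).+1 w < +oo)%E by rewrite (le_lt_trans t1)// ltry.
  by move/(jump_chain_neq (X_rc w)); rewrite cx; apply.
rewrite [X in measurable X](_ : _ = X s @^-1` [set j] `&`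
  \bigcup_(q in [set q : rat | 0 <= (ratr q : R) < s])
    (history_at X (x :: p) (ratr q) `&`
    \bigcap_(r in [set r | (ratr q : R) <= sample_time s r <= s])
      (X (sample_time s r) @^-1` [set x] `|`
      \bigcap_(r' in [set r' | sample_time s r <= sample_time s r' <= s])
         X (sample_time s r') @^-1` [set j]))); last first.
  apply/seteqP; split=> w; rewrite (history_at_cons (X_rc w))//.
    by move=> [Xs [q [qs hq H]]]; split=> //; exists q.
  by move=> [Xs [q qs [hq H]]]; split=> //; exists q.
apply: measurableI; first exact: mX.
apply: bigcup_countType_measurable => q /= /andP[q0 qs].
apply: measurableI; first by apply: IH; rewrite q0 (le_trans (ltW qs)).
apply: bigcap_countType_measurable => r /= /andP[qr rs].
apply: measurableU; first by apply: mX; rewrite (le_trans q0)//= (le_trans rs).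
apply: bigcap_countType_measurable => r' /= /andP[rr' r's]; apply: mX.
by rewrite (le_trans q0)/= ?(le_trans r's)// (le_trans qr).
Qed.

Lemma followed_by_measurable (g : seq V) :
  0 <= t -> measurable (followed_by X g t).
Proof.
move=> t0; rewrite [X in measurable X](_ : _ =
    \bigcup_(q in [set q | 0 <= sample_time t q <= t]) history_at X g (sample_time t q)).
  by apply: bigcup_countType_measurable => q /= ?; exact: history_at_measurable.
by apply/seteqP; split=> w; rewrite (followed_by_sample (X_rc w))//; move=> [q]; exists q.
Qed.

End history_measurable.

Lemma history_at_natural_filtration (R : realType) (V : choiceType)
    (d : measure_display) (T : measurableType d) (X : R -> T -> V) (o : V) (g : seq V)
    (t : R) :
  (forall w (t : R), 0 <= t -> \forall s \near t^'+, X s w = X t w) ->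
  (forall w, X 0 w = o) -> 0 <= t ->
  natural_filtration X t (history_at X g t).
Proof.
move=> X_rc X_start t0.
set G := [set A | exists s (B : set V), 0 <= s <= t /\ A = X s @^-1` B].
(* Here [T] carries the sigma-algebra generated by the positions up to [t]; being measurable in it
   means belonging to the filtration. *)
apply: (@history_at_measurable R V _ (g_sigma_algebraType G) X o t) => //.
  by move=> s B st; apply: sub_sigma_algebra; exists s, B.
by rewrite t0 lexx.
Qed.

(** * Uniform infinitesimal errors *)

Section little_oh.
Variable R : realType.
Implicit Types eps : R -> R.

Lemma is_little_ohP eps : is_little_oh eps <->
  forall c, 0 < c -> exists2 r, 0 < r & forall h, 0 < h < r -> `|eps h| <= c * h.
Proof.
split=> [/cvgrPdist_le H c c0|H].
  have := H c c0; rewrite /at_right !nearE /within /= => /nbhs_ballP[r /= r0 Hr].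
  exists r => // h /andP[h0 hr]; have /(_ _ h0) := Hr h _.
  rewrite /ball/= sub0r normrN gtr0_norm// => /(_ hr).
  by rewrite sub0r normrN normrM normfV (gtr0_norm h0) ler_pdivrMr.
apply/cvgrPdist_le => c c0; have [r r0 Hr] := H c c0.
near=> h; have h0 : 0 < h by near: h; exact: nbhs_right_gt.
rewrite sub0r normrN normrM normfV (gtr0_norm h0) ler_pdivrMr//; apply: Hr.
by rewrite h0/=; near: h; exact: nbhs_right_lt.
Unshelve. all: by end_near. Qed.

Lemma is_little_oh_norm eps : is_little_oh eps -> is_little_oh (fun h => `|eps h|).
Proof.
move=> /is_little_ohP H; apply/is_little_ohP => c /H[r r0 Hr]; exists r => // h /Hr.
by rewrite normr_id.
Qed.

Lemma is_little_ohD eps1 eps2 : is_little_oh eps1 -> is_little_oh eps2 ->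
  is_little_oh (eps1 \+ eps2).
Proof.
move=> H1 H2; rewrite /is_little_oh; under eq_fun do rewrite /= mulrDl.
by have := cvgD H1 H2; rewrite addr0; exact.
Qed.

Lemma is_little_ohZ k eps : is_little_oh eps -> is_little_oh (fun h => k * eps h).
Proof.
move=> H; rewrite /is_little_oh; under eq_fun do rewrite -mulrA.
by have := cvgM (cvg_cst k) H; rewrite mulr0; exact.
Qed.

Lemma is_little_oh_double eps : is_little_oh eps -> is_little_oh (fun h => eps (2 * h)).
Proof.
move=> /is_little_ohP H; apply/is_little_ohP => c c0.
have [|r r0 Hr] := H (c / 2); first lra.
exists (r / 2); first lra.
move=> h h0; have := Hr (2 * h); rewrite -mulrA mulKf ?pnatr_eq0//.
by apply; lra.
Qed.

(* Telescoping over a mesh h -> 0: the accumulated error is (t - t0) * o(1). *)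
Lemma little_oh_nondecreasing (f err : R -> R) (t0 t : R) : is_little_oh err ->
  (forall s h, t0 <= s -> 0 < h -> f s - err h <= f (s + h)) ->
  t0 <= t -> f t0 <= f t.
Proof.
move=> /is_little_ohP err0 H; rewrite le_eqVlt => /predU1P[->//|tt].
apply/ler_addgt0Pr => c c0.
have K0 : 0 < t - t0 by lra.
have [r r0 Hr] := err0 _ (divr_gt0 c0 K0).
pose n := (Num.truncn ((t - t0) / r)).+1.
have n0 : 0 < n%:R :> R by rewrite ltr0n.
pose h := (t - t0) / n%:R.
have h0 : 0 < h by rewrite divr_gt0.
have hr : h < r by rewrite ltr_pdivrMr// mulrC -ltr_pdivrMr// truncnS_gt.
have nh : n%:R * h = t - t0 by rewrite mulrC divfK// gt_eqF.
have step (m : nat) : f t0 - m%:R * err h <= f (t0 + m%:R * h).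
  elim: m => [|m IH]; first by rewrite !mul0r subr0 addr0.
  have mh : 0 <= m%:R * h by rewrite mulr_ge0// ltW.
  have -> : t0 + m.+1%:R * h = t0 + m%:R * h + h by rewrite -natr1 mulrDl mul1r addrA.
  have := H (t0 + m%:R * h) h _ h0; rewrite lerDl => /(_ mh).
  by rewrite -natr1 mulrDl mul1r; lra.
have := step n; rewrite nh (addrC t0) subrK.
have errh : `|err h| <= c / (t - t0) * h by apply: Hr; rewrite h0.
have : n%:R * err h <= c.
  rewrite (@le_trans _ _ (n%:R * `|err h|)) ?ler_wpM2l ?ler_norm//.
  rewrite (@le_trans _ _ (n%:R * (c / (t - t0) * h)))// ?ler_wpM2l//.
  by rewrite mulrCA nh divfK// gt_eqF.
lra.
Qed.

End little_oh.

(** * Edge weights along a history, and measurability of jump-time events *)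

Fixpoint crossed (V : choiceType) (g : seq V) (i j : V) : bool :=
  if g is y :: p then
    if p is x :: _ then
      (x == i) && (y == j) || (x == j) && (y == i) || crossed p i j
    else false
  else false.

(** The jump rate along the edge {i, j} after the history [g], a constant because the history
    determines the traversed edges. *)
Definition edge_weight (R : realType) (V : choiceType) (a : R) (g : seq V)
    (i j : V) : R :=
  if crossed g i j then 1 else a.

Fixpoint walks (V : choiceType) (nb : V -> seq V) (o : V) (n : nat) : seq (seq V) :=
  if n is m.+1 then [seq j :: g | g <- walks nb o m, j <- nb (head o g)]
  else [:: [:: o]].

Lemma size_walks (V : choiceType) (nb : V -> seq V) (o : V) (n : nat) g :
  g \in walks nb o n -> size g = n.+1.
Proof.
elim: n g => [|n IH] g /=; first by rewrite inE => /eqP->.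
by move=> /allpairsPdep[p [j [/IH ps _ ->]]] /=; rewrite ps.
Qed.

Section orrw.
Variables (R : realType) (V : choiceType) (e : rel V) (o : V) (a : R).
Variables (d : measure_display) (T : measurableType d) (P : probability T R).
Variables (X : R -> T -> V) (XP : orrw e o a P X).
Variables (nb : V -> seq V) (nbE : forall x y, (y \in nb x) = e x y).

Let X_rc := orrw_right_continuous XP.
Let X_start := orrw_start XP.
Local Notation pr A := (fine (P A)).

Lemma crossedP (n : nat) (i j : V) w :
  reflect (exists2 m, (m < n)%N &
      (jump_chain X m w = i /\ jump_chain X m.+1 w = j) \/
      (jump_chain X m w = j /\ jump_chain X m.+1 w = i))
    (crossed (history X n w) i j).
Proof.
elim: n => [|n IH]; first by constructor => -[].
have -> : crossed (history X n.+1 w) i j =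
    [|| (jump_chain X n w == i) && (jump_chain X n.+1 w == j),
        (jump_chain X n w == j) && (jump_chain X n.+1 w == i)
      | crossed (history X n w) i j].
  by rewrite /= orbA; case: (n).
apply: (iffP or3P) => [[/andP[/eqP ? /eqP ?]|/andP[/eqP ? /eqP ?]|/IH[m mn H]]|[m]].
- by exists n => //; left.
- by exists n => //; right.
- by exists m => //; exact: ltnW.
- rewrite ltnS leq_eqVlt => /predU1P[->|mn] H; last by constructor 3; apply/IH; exists m.
  by case: H => -[-> ->]; [constructor 1|constructor 2]; rewrite !eqxx.
Qed.

Lemma head_history n w : head o (history X n w) = jump_chain X n w.
Proof. by case: n. Qed.

(** At such a time the jumps made are exactly those recorded in [g], so the traversed edges are the
    pairs of consecutive vertices of [g]. *)
Lemma history_at_traversed (g : seq V) (t : R) (i j : V) w :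
  history_at X g t w -> traversed X t i j w <-> crossed g i j.
Proof.
case=> -[tn hn] tS; split=> [[m [tm H]]|].
  rewrite -hn; apply/crossedP; exists m => //.
  rewrite ltnNge; apply/negP => gm.
  have sm : (size g <= m.+1)%N by rewrite (leq_trans (leqSpred _)).
  have := lt_le_trans tS (le_trans (jump_time_mono (X_rc w) sm) tm).
  by rewrite /= ltxx.
rewrite -hn => /crossedP[m mn H]; exists m; split=> //.
exact: le_trans (jump_time_mono (X_rc w) mn) tn.
Qed.

Lemma history_walks n w : (jump_time X n w < +oo)%E -> history X n w \in walks nb o n.
Proof.
elim: n => [_|n IH tS]; first by rewrite /= inE /jump_chain /= X_start.
apply/allpairsPdep; exists (history X n w), (jump_chain X n.+1 w); split=> //.
  by apply: IH; exact: jump_timeS_ltyP tS.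
by rewrite nbE head_history; exact: orrw_nearest_neighbour XP w n tS.
Qed.

Lemma orrw_preimage_measurable (t s : R) (B : set V) :
  0 <= s <= t -> measurable (X s @^-1` B).
Proof. by case/andP => s0 _; exact: orrw_measurable XP s B s0. Qed.

Lemma orrw_history_at_measurable g (t : R) : 0 <= t -> measurable (history_at X g t).
Proof.
move=> t0; apply: (history_at_measurable X_rc X_start (@orrw_preimage_measurable t)).
by rewrite t0 lexx.
Qed.

Lemma orrw_followed_by_measurable g (t : R) : 0 <= t -> measurable (followed_by X g t).
Proof.
move=> t0.
exact: (followed_by_measurable X_rc X_start (@orrw_preimage_measurable t)).
Qed.

(** [V] is not assumed countable, but only finitely many walks along [nb] can be the history after
    [n] jumps. *)
Lemma jump_time_le_measurable n (t : R) : 0 <= t ->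
  measurable [set w | (jump_time X n w <= t%:E)%E].
Proof.
move=> t0; rewrite [X in measurable X](_ : _ =
    \bigcup_(g in [set` walks nb o n]) followed_by X g t).
  by apply: fin_bigcup_measurable => // g _; exact: orrw_followed_by_measurable.
apply/seteqP; split=> w /=.
  move=> tn; exists (history X n w) => /=.
    by apply: history_walks; rewrite (le_lt_trans tn)// ltry.
  have sz : (size (history X n w)).-1 = n by case: (n) => //= m; elim: m => //= m ->.
  by rewrite /followed_by /= sz.
by move=> [g /= /size_walks sz]; rewrite /followed_by/= sz /= => -[].
Qed.

Lemma jump_time_lt_measurable n (t : R) :
  measurable [set w | (jump_time X n w < t%:E)%E].
Proof.
rewrite [X in measurable X](_ : _ = \bigcup_(q in [set q : rat | 0 <= (ratr q : R) < t])
    [set w | (jump_time X n w <= (ratr q : R)%:E)%E]).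
  apply: bigcup_countType_measurable => q /= /andP[q0 _].
  exact: jump_time_le_measurable.
apply/seteqP; split=> w /=.
  move=> tn; have [q [tq qt _ _]] := rat_in_holding (X_rc w) tn.
  exists q; last exact: ltW.
  by rewrite /= qt andbT -lee_fin (le_trans (jump_time_ge0 X w n))// ltW.
by move=> [q /= /andP[q0 qt]] /le_lt_trans; apply; rewrite lte_fin.
Qed.

Lemma multiple_jumps_measurable (t h : R) : 0 <= t -> measurable (multiple_jumps X t h).
Proof.
move=> t0; rewrite [X in measurable X](_ : _ =
    \bigcup_n (~` [set w | (jump_time X n w <= t%:E)%E] `&`
               [set w | (jump_time X n.+1 w < (t + h)%:E)%E])).
  apply: bigcup_measurable => n _; apply: measurableI.
    by apply: measurableC; exact: jump_time_le_measurable.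
  exact: jump_time_lt_measurable.
apply/seteqP; split=> w /=.
  by move=> [n [tn nt]]; exists n => //; split=> //=; apply/negP; rewrite -ltNge.
by move=> [n _ [/negP]]; rewrite -ltNge; exists n.
Qed.

End orrw.

(** * Real-valued probabilities and integration of a conditional probability *)

Section real_probability.
Variables (R : realType) (d : measure_display) (T : measurableType d).
Variable P : probability T R.
Local Notation pr A := (fine (P A)).
Implicit Types A B : set T.

Lemma pr_fineK A : measurable A -> (pr A)%:E = P A.
Proof. by move=> mA; rewrite fineK// fin_num_measure. Qed.

Lemma pr_ge0 A : 0 <= pr A.
Proof. exact: fine_ge0. Qed.

Lemma pr_le1 A : measurable A -> pr A <= 1.
Proof. by move=> mA; rewrite -lee_fin pr_fineK// probability_le1. Qed.

Lemma pr_le A B : measurable A -> measurable B -> A `<=` B -> pr A <= pr B.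
Proof. by move=> mA mB AB; rewrite -lee_fin !pr_fineK// le_measure ?inE. Qed.

Lemma pr_leU A B C : measurable A -> measurable B -> measurable C ->
  A `<=` B `|` C -> pr A <= pr B + pr C.
Proof.
move=> mA mB mC ABC; rewrite -lee_fin EFinD !pr_fineK//.
rewrite (@le_trans _ _ (P (B `|` C)))//; last exact: measureU2.
by rewrite le_measure ?inE//; exact: measurableU.
Qed.

Lemma pr_setD A B : measurable A -> measurable B -> A `<=` B ->
  pr (B `\` A) = pr B - pr A.
Proof.
move=> mA mB AB; apply: EFin_inj; rewrite EFinB !pr_fineK//; last exact: measurableD.
rewrite measureD//; last by rewrite -ge0_fin_numE ?fin_num_measure.
by rewrite setIidr.
Qed.

(** Integrate [Z - c] over [A]: since [A] lies in [F], the integral of [Z] is P(A and B), and P(A)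
    is at most 1. The bound is the absolute value of [r] because a negligible [A] allows a negative
    [r]. *)
Lemma conditional_prob_close (F : set (set T)) A B (Z : T -> R) (c r : R) :
  is_cond_prob P F B Z -> F A -> measurable A -> measurable B ->
  {ae P, forall w, A w -> `|Z w - c| <= r} ->
  `|pr (A `&` B) - c * pr A| <= `|r|.
Proof.
move=> [_ intZ HZ] FA mA mB Zc.
have intZA : P.-integrable A (EFin \o Z) by exact: integrableS intZ.
have intc : P.-integrable A (EFin \o cst c).
  by apply: finite_measure_integrable_cst.
have intf : P.-integrable A (EFin \o (fun w => Z w - c)).
  have -> : EFin \o (fun w => Z w - c) = ((EFin \o Z) \- (EFin \o cst c))%E by [].
  exact: integrableB.
have -> : pr (A `&` B) - c * pr A = fine (\int[P]_(w in A) (Z w - c)%:E)%E.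
  rewrite integralB_EFin// HZ// integral_cst// fineB ?fin_num_measure//.
  - by rewrite fineM// fin_num_measure.
  - exact: measurableI.
  - by rewrite fin_numM// fin_num_measure.
rewrite -lee_fin -abse_EFin fineK ?integrable_fin_num//.
apply: (le_trans (le_abse_integral _ mA (measurable_int _ intf))).
apply: (@le_trans _ _ (\int[P]_(w in A) `|r|%:E)%E).
  apply: ae_ge0_le_integral => //.
  - exact: (measurableT_comp (@abse_measurable R setT) (measurable_int _ intf)).
  - move: Zc; apply: filterS => w Hw /Hw; rewrite abse_EFin lee_fin => /le_trans; apply.
    exact: ler_norm.
rewrite integral_cst// -[leRHS]mule1 lee_pmul//.
exact: probability_le1.
Qed.

End real_probability.

(** * The law of the jump chain *)

Section orrw_law.
Variables (R : realType) (V : choiceType) (e : rel V) (o : V) (a : R).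
Variables (d : measure_display) (T : measurableType d) (P : probability T R).
Variables (X : R -> T -> V) (XP : orrw e o a P X).
Variables (nb : V -> seq V) (nbE : forall x y, (y \in nb x) = e x y).
Hypothesis e_irr : irreflexive e.
Hypothesis a_gt0 : 0 < a.

Let X_rc := orrw_right_continuous XP.
Let X_start := orrw_start XP.
Local Notation pr A := (fine (P A)).
Local Notation mhist := (orrw_history_at_measurable XP).
Local Notation mfoll := (orrw_followed_by_measurable XP).

Lemma history_at_pos (g : seq V) (x : V) (t : R) w :
  history_at X (x :: g) t w -> X t w = x.
Proof.
case=> -[tn hn] tS; have := jump_chain_const tn tS.
by move: hn => /=; case: (size g) => [|m] [-> _].
Qed.

Lemma edge_weight_gt0 (g : seq V) x j : 0 < edge_weight a g x j.
Proof. by rewrite /edge_weight; case: ifP. Qed.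

(** The history at [t] fixes which edges are traversed, so on this event the conditional rate in
    [orrw_jump_rate] is the constant [edge_weight]. The event belongs to the natural filtration, so
    the rate can be integrated over it. *)
Lemma jump_rate_history (x j : V) (p : seq V) : e x j ->
  exists2 err : R -> R, is_little_oh err & forall t h : R, 0 <= t -> 0 < h ->
  `|pr (history_at X (x :: p) t `&` X (t + h) @^-1` [set j]) -
    edge_weight a (x :: p) x j * h * pr (history_at X (x :: p) t)| <= err h.
Proof.
move=> exj; have [eps eps0 H] := orrw_jump_rate XP exj.
exists (fun h => `|eps h|); first exact: is_little_oh_norm.
move=> t h t0 h0; have [Z HZ Zae] := H t h t0 h0.
apply: (conditional_prob_close HZ).
- exact: history_at_natural_filtration X_rc X_start t0.
- exact: mhist.
- by apply: (orrw_measurable XP [set j] (t := t + h)); rewrite addr_ge0// ltW.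
move: Zae; apply: filterS => w Hw Aw; have := Hw (history_at_pos Aw).
have trE := history_at_traversed XP x j Aw.
rewrite !indicE /edge_weight; case: ifPn => cr.
  by rewrite mem_set ?trE// memNset ?mulr0 ?addr0 ?mulr1 ?mul1r//= trE.
by rewrite memNset ?mem_set ?mulr0 ?add0r ?mulr1//= trE; exact/negP.
Qed.

(** At most one jump occurs in (t, t + h], so completing [j :: x :: p] in that window means being at
    [x :: p] at [t] and at [j] at the end. The excluded window has length [2 * h] because
    [multiple_jumps] counts a second jump only strictly before its end, whereas one at [t + h]
    matters here. *)
Lemma history_at_jump (x j : V) (p : seq V) (t h : R) w :
  0 <= t -> 0 < h -> j <> x -> ~ multiple_jumps X t (2 * h) w ->
  (followed_by X (j :: x :: p) (t + h) `\` followed_by X (j :: x :: p) t) w <->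
  (history_at X (x :: p) t `&` X (t + h) @^-1` [set j]) w.
Proof.
move=> t0 h0 jx NM; set n := size p.
have late m : (t%:E < jump_time X m w)%E -> ((t + h)%:E < jump_time X m.+1 w)%E.
  move=> tm; rewrite ltNge; apply/negP => mt; apply: NM; exists m; split=> //.
  by rewrite (le_lt_trans mt)// lte_fin; lra.
split=> [[[/= t1 h1] nt1]|[Aw /= Xth]].
  have tS : (t%:E < jump_time X n.+1 w)%E.
    by rewrite ltNge; apply/negP => tS; apply: nt1; split.
  case: h1 => cj hx.
  split; last by rewrite /= -cj; apply: jump_chain_const => //; exact: late.
  split=> //; split=> //=; rewrite leNgt; apply/negP => /late.
  by rewrite ltNge t1.
have [[/= tn hn] tS] := Aw.
have cx : jump_chain X n w = x by move: hn; rewrite /n; case: (size p) => [|m] /= [].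
have t1 : (jump_time X n.+1 w <= (t + h)%:E)%E.
  apply: jump_time_le; first by rewrite (le_lt_trans tn)// lte_fin; lra.
  by rewrite Xth cx.
have cj : jump_chain X n.+1 w = j.
  by rewrite -Xth; symmetry; apply: jump_chain_const t1 _; exact: late.
split; first by split=> //=; rewrite cj hn.
by move=> [/= tS' _]; move: tS; rewrite /= ltNge => /negP; apply.
Qed.

(** Discrete form of growth at rate weight times P(currently at [x :: p]). The two events compared
    by [history_at_jump] differ only inside [multiple_jumps], whose probability is o(h) uniformly in
    [t]. *)
Lemma jump_increment (x j : V) (p : seq V) : e x j ->
  exists2 err : R -> R, is_little_oh err & forall t h : R, 0 <= t -> 0 < h ->
  `|pr (followed_by X (j :: x :: p) (t + h)) - pr (followed_by X (j :: x :: p) t) -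
    edge_weight a (x :: p) x j * h * pr (history_at X (x :: p) t)| <= err h.
Proof.
move=> exj; have [err1 err10 H1] := jump_rate_history p exj.
have [eps eps0 H2] := orrw_multiple_jumps XP.
exists (err1 \+ (fun h => eps (2 * h))).
  by apply: is_little_ohD => //; exact: is_little_oh_double.
move=> t h t0 h0; have := H1 t h t0 h0; have := H2 t (2 * h) t0 (mulr_gt0 (ltr0Sn _ _) h0).
have jx : j <> x by move=> E; move: exj; rewrite E e_irr.
have th0 : 0 <= t + h by lra.
have mM : measurable (multiple_jumps X t (2 * h)).
  exact: (multiple_jumps_measurable XP nbE).
have mB : measurable (history_at X (x :: p) t `&` X (t + h) @^-1` [set j]).
  by apply: measurableI; [exact: mhist|exact: (orrw_measurable XP)].
rewrite -pr_setD; [|exact: mfoll|exact: mfoll|]; last first.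
  by move=> w [tn hn]; split=> //; rewrite (le_trans tn)// lee_fin; lra.
rewrite -pr_fineK// lee_fin.
set D := _ `\` _; set B := _ `&` _; set M := multiple_jumps _ _ _.
have mD : measurable D by apply: measurableD; exact: mfoll.
have DB : pr D <= pr B + pr M.
  apply: pr_leU => // w Dw; have [Mw|NM] := pselect (M w); first by right.
  by left; apply/(history_at_jump _ t0 h0 jx NM).
have BD : pr B <= pr D + pr M.
  apply: pr_leU => // w Dw; have [Mw|NM] := pselect (M w); first by right.
  by left; apply/(history_at_jump _ t0 h0 jx NM).
move=> PM; rewrite !ler_norml => /andP[? ?]; apply/andP; split => /=; lra.
Qed.

End orrw_law.

Lemma pr_bigcup_seq (R : realType) (d : measure_display) (T : measurableType d)
    (P : probability T R) (I : choiceType) (s : seq I) (F : I -> set T) :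
  uniq s -> trivIset [set` s] F -> (forall i, measurable (F i)) ->
  fine (P (\bigcup_(i in [set` s]) F i)) = \sum_(i <- s) fine (P (F i)).
Proof.
move=> us tF mF; apply: EFin_inj; rewrite pr_fineK; last first.
  exact: fin_bigcup_measurable.
rewrite measure_fin_bigcup// -fsbig_seq// -sumEFin.
by apply: eq_bigr => i _; rewrite pr_fineK.
Qed.

Section orrw_chain.
Variables (R : realType) (V : choiceType) (e : rel V) (o : V) (a : R).
Variables (d : measure_display) (T : measurableType d) (P : probability T R).
Variables (X : R -> T -> V) (XP : orrw e o a P X).
Variables (nb : V -> seq V) (nbE : forall x y, (y \in nb x) = e x y).
Hypothesis nb_uniq : forall x, uniq (nb x).
Hypothesis e_irr : irreflexive e.
Hypothesis a_gt0 : 0 < a.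

Let X_rc := orrw_right_continuous XP.
Local Notation pr A := (fine (P A)).
Local Notation mfoll := (orrw_followed_by_measurable XP).

Lemma followed_by_cons0 (j x : V) (p : seq V) : followed_by X (j :: x :: p) 0 = set0.
Proof.
apply/seteqP; split=> // w [/= t1 _]; have tlt : (jump_time X (size p) w < 0)%E.
  apply: lt_le_trans (t1); apply: jump_time_lt (X_rc w) _ _; apply: jump_timeS_ltyP.
  by rewrite (le_lt_trans t1)// ltry.
by have := jump_time_ge0 X w (size p); rewrite leNgt tlt.
Qed.

(** In [f] the main terms of both increments equal wi wj h P(currently at [x :: p]) and cancel,
    which leaves o(h). Monotonicity up to o(h) gives one inequality; exchanging the two neighbours
    gives the other. *)
Lemma followed_by_ratio (x i j : V) (p : seq V) (t : R) : e x i -> e x j -> 0 <= t ->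
  edge_weight a (x :: p) x i * pr (followed_by X (j :: x :: p) t) =
  edge_weight a (x :: p) x j * pr (followed_by X (i :: x :: p) t).
Proof.
move=> + + t0; suff H i' j' : e x i' -> e x j' ->
    edge_weight a (x :: p) x i' * pr (followed_by X (j' :: x :: p) t) <=
    edge_weight a (x :: p) x j' * pr (followed_by X (i' :: x :: p) t).
  by move=> xi xj; apply/eqP; rewrite eq_le !H.
move=> xi xj; have [erri erri0 Hi] := jump_increment XP nbE e_irr p xi.
have [errj errj0 Hj] := jump_increment XP nbE e_irr p xj.
have := edge_weight_gt0 a_gt0 (x :: p) x i'; have := edge_weight_gt0 a_gt0 (x :: p) x j'.
set wi := edge_weight _ _ _ i' in Hi *; set wj := edge_weight _ _ _ j' in Hj * => wj0 wi0.
pose f s := wj * pr (followed_by X (i' :: x :: p) s) - wi * pr (followed_by X (j' :: x :: p) s).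
have f0 : f 0 = 0 by rewrite /f !followed_by_cons0 measure0 /= !mulr0 subrr.
suff : f 0 <= f t by rewrite f0 /f; lra.
apply: (@little_oh_nondecreasing _ _ ((fun h => wj * erri h) \+ (fun h => wi * errj h))) t0.
  by apply: is_little_ohD; exact: is_little_ohZ.
move=> s h s0 h0; have := Hi s h s0 h0; have := Hj s h s0 h0.
rewrite /f /=; move: (pr (history_at _ _ _)) => A.
rewrite !ler_norml => /andP[_ Bj] /andP[Bi _].
have := ler_wpM2l (ltW wj0) Bi; have := ler_wpM2l (ltW wi0) Bj.
lra.
Qed.

Lemma follows_bigcup g : follows X g = \bigcup_n followed_by X g n%:R.
Proof.
apply/seteqP; split=> [w [tn hn]|w [n _ [tn hn]]]; last first.
  by split=> //; rewrite (le_lt_trans tn)// ltry.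
have [u u0 E] := jump_time_fin tn; exists (Num.truncn u).+1 => //; split=> //.
by rewrite E lee_fin ltW// truncnS_gt.
Qed.

Lemma follows_measurable g : measurable (follows X g).
Proof. by rewrite follows_bigcup; apply: bigcup_measurable => n _; exact: mfoll. Qed.

Lemma followed_by_cvg g :
  pr (followed_by X g n%:R) @[n --> \oo] --> pr (follows X g).
Proof.
apply: fine_cvg; rewrite pr_fineK; last exact: follows_measurable.
rewrite follows_bigcup; apply: nondecreasing_cvg_mu.
- by move=> n; exact: mfoll.
- by apply: bigcup_measurable => n _; exact: mfoll.
- move=> m n mn; apply/subsetPset => w [tm hm]; split=> //.
  by rewrite (le_trans tm)// lee_fin ler_nat.
Qed.

Lemma follows_ratio (x i j : V) (p : seq V) : e x i -> e x j ->
  edge_weight a (x :: p) x i * pr (follows X (j :: x :: p)) =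
  edge_weight a (x :: p) x j * pr (follows X (i :: x :: p)).
Proof.
move=> xi xj.
have H k l : k * pr (followed_by X (l :: x :: p) n%:R) @[n --> \oo] -->
    k * pr (follows X (l :: x :: p)) by apply: cvgM; [exact: cvg_cst|exact: followed_by_cvg].
have := H (edge_weight a (x :: p) x i) j.
under eq_fun do rewrite (followed_by_ratio _ xi xj)//.
by move=> Hj; exact: cvg_unique Hj (H _ i).
Qed.

Lemma follows_cons_sub (j x : V) (p : seq V) : follows X (j :: x :: p) `<=` follows X (x :: p).
Proof. by move=> w [/= tS [_ h]]; split=> //; exact: jump_timeS_ltyP tS. Qed.

Lemma follows_trivIset (D : set V) (g : seq V) :
  trivIset D (fun j => follows X (j :: g)).
Proof.
move=> i j _ _ [w [[_ /= hi] [_ /= hj]]]; move: hi; rewrite hj.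
by case.
Qed.

Lemma follows_next (x : V) (p : seq V) w : follows X (x :: p) w ->
  (jump_time X (size p).+1 w < +oo)%E ->
  (\bigcup_(j in [set` nb x]) follows X (j :: x :: p)) w.
Proof.
move=> [/= tn hn] tS; exists (jump_chain X (size p).+1 w); last by split => //=; rewrite hn.
have cx : jump_chain X (size p) w = x by move: hn; case: (size p) => [|m] /= [].
by rewrite /= nbE -cx; exact: orrw_nearest_neighbour XP w (size p) tS.
Qed.

(** If with probability [c > 0] the walk were at [x :: p] by time [k] and stayed forever, the
    probability of having followed [j0 :: x :: p] would from then on grow at rate at least [w0 * c]
    and finally exceed 1. *)
Lemma never_stops (x j0 : V) (p : seq V) : e x j0 ->
  pr (follows X (x :: p) `\` \bigcup_(j in [set` nb x]) follows X (j :: x :: p)) = 0.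
Proof.
move=> xj0; set N := _ `\` _.
have mN : measurable N.
  apply: measurableD; first exact: follows_measurable.
  by apply: fin_bigcup_measurable => // j _; exact: follows_measurable.
have mNk k : measurable (N `&` followed_by X (x :: p) k%:R).
  by apply: measurableI => //; exact: mfoll.
have Nk k : pr (N `&` followed_by X (x :: p) k%:R) = 0.
  apply/eqP; rewrite eq_le pr_ge0 andbT leNgt; apply/negP; set c := pr _ => c0.
  have [err err0 H] := jump_increment XP nbE e_irr p xj0.
  have := edge_weight_gt0 a_gt0 (x :: p) x j0; set w0 := edge_weight _ _ _ _ in H * => w00.
  pose f s := pr (followed_by X (j0 :: x :: p) s) - w0 * c * s.
  have wc0 : 0 < w0 * c by rewrite mulr_gt0.
  (* Over a duration [2 / (w0 * c)] the growth is at least 2, more than a probability allows. *)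
  have kt : k%:R <= k%:R + 2 / (w0 * c) by rewrite lerDl divr_ge0// ltW.
  have : f k%:R <= f (k%:R + 2 / (w0 * c)).
    apply: little_oh_nondecreasing err0 _ kt => s h ks h0.
    have s0 : 0 <= s by rewrite (le_trans _ ks).
    have cs : c <= pr (history_at X (x :: p) s).
      apply: pr_le => //; first exact: orrw_history_at_measurable XP _ _ s0.
      move=> w [[Cw NS] [tk hk]]; split.
        by split=> //; rewrite (le_trans tk)// lee_fin.
      (* A next jump would lead to a neighbour of [x] and take the path out of [N]. *)
      rewrite /= ltNge; apply/negP => tS; apply: NS; apply: follows_next => //.
      by rewrite (le_lt_trans tS)// ltry.
    have := H s h s0 h0; rewrite ler_norml => /andP[B _].
    have := ler_wpM2l (ltW (mulr_gt0 w00 h0)) cs; rewrite /f mulrDr; lra.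
  rewrite /f mulrDr [X in _ - (_ + X)]mulrC divfK ?gt_eqF//.
  have := @pr_ge0 _ _ _ P (followed_by X (j0 :: x :: p) k%:R).
  have := pr_le1 P (mfoll (j0 :: x :: p) (le_trans (ler0n R k) kt)).
  lra.
have NE : N = \bigcup_k (N `&` followed_by X (x :: p) k%:R).
  by rewrite -setI_bigcupr -follows_bigcup setIidl// => w [].
have /(measure_negligible mN) -> : P.-negligible N; last by [].
rewrite NE; apply: negligible_bigcup => k; apply/(negligibleP _ (mNk k)).
by have := pr_fineK P (mNk k); rewrite Nk => /esym.
Qed.

Lemma sum_follows (x : V) (p : seq V) :
  \sum_(j <- nb x) pr (follows X (j :: x :: p)) <= pr (follows X (x :: p)).
Proof.
rewrite -pr_bigcup_seq//; [|exact: follows_trivIset|by move=> j; exact: follows_measurable].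
apply: pr_le; first by apply: fin_bigcup_measurable => // j _; exact: follows_measurable.
  exact: follows_measurable.
by move=> w [j _]; exact: follows_cons_sub.
Qed.

Lemma follows_le_sum (x j0 : V) (p : seq V) : e x j0 ->
  pr (follows X (x :: p)) <= \sum_(j <- nb x) pr (follows X (j :: x :: p)).
Proof.
move=> xj0.
rewrite -pr_bigcup_seq//; [|exact: follows_trivIset|by move=> j; exact: follows_measurable].
rewrite -[leRHS]addr0 -(never_stops p xj0).
have mU : measurable (\bigcup_(i in [set` nb x]) follows X [:: i, x & p]).
  by apply: fin_bigcup_measurable => // j _; exact: follows_measurable.
apply: pr_leU => //; first exact: follows_measurable.
  by apply: measurableD => //; exact: follows_measurable.
by move=> w Cw; have [?|?] := pselect ((\bigcup_(i in [set` nb x]) follows X [:: i, x & p]) w);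
  [left|right].
Qed.

(* Reinforcement by a <= 1 favours an edge by at most a factor 1 / a. *)
Lemma follows_cons_le (x j : V) (p : seq V) : a <= 1 -> e x j ->
  a * (size (nb x))%:R * pr (follows X (j :: x :: p)) <= pr (follows X (x :: p)).
Proof.
move=> a1 xj; apply: le_trans (sum_follows x p).
have -> : a * (size (nb x))%:R * pr (follows X (j :: x :: p)) =
    \sum_(i <- nb x) a * pr (follows X (j :: x :: p)).
  by rewrite big_const_seq count_predT iter_addr_0 mulrAC mulr_natr.
rewrite big_seq [leRHS]big_seq; apply: ler_sum => i; rewrite nbE => xi.
have wP k : a <= edge_weight a (x :: p) x k <= 1.
  by rewrite /edge_weight; case: ifP => _; rewrite ?a1 lexx.
have /andP[ai _] := wP i; have /andP[_ j1] := wP j.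
have := ler_wpM2r (pr_ge0 P (follows X (j :: x :: p))) ai.
have := ler_wpM2r (pr_ge0 P (follows X (i :: x :: p))) j1.
by rewrite mul1r -(follows_ratio p xi xj) => + H; exact: le_trans.
Qed.

(** With all weights equal to 1 the neighbours are equally likely, and by [never_stops] the walk
    almost surely moves on to one of them. *)
Lemma follows_cons1 (x j : V) (p : seq V) : a = 1 -> e x j ->
  pr (follows X (x :: p)) <= (size (nb x))%:R * pr (follows X (j :: x :: p)).
Proof.
move=> a1 xj; apply: le_trans (follows_le_sum p xj) _.
have -> : (size (nb x))%:R * pr (follows X (j :: x :: p)) =
    \sum_(i <- nb x) pr (follows X (j :: x :: p)).
  by rewrite big_const_seq count_predT iter_addr_0 mulr_natl.
rewrite big_seq [leRHS]big_seq; apply: ler_sum => i; rewrite nbE => xi.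
have w1 k : edge_weight a (x :: p) x k = 1 by rewrite /edge_weight a1; case: ifP.
by have := follows_ratio p xi xj; rewrite !w1 !mul1r => ->.
Qed.

End orrw_chain.

(** * Return probabilities *)

(** The probability that simple random walk from [x] hits [o] in steps 1 to [k], by conditioning on
    the first step. It depends on the graph only and so links walks living on different probability
    spaces. *)
Fixpoint return_prob (R : realType) (V : choiceType) (nb : V -> seq V) (o : V)
    (k : nat) (x : V) : R :=
  if k is k'.+1 then
    (size (nb x))%:R^-1 *
    \sum_(j <- nb x) (if j == o then 1 else return_prob R nb o k' j)
  else 0.

Lemma return_prob_ge0 (R : realType) (V : choiceType) (nb : V -> seq V) (o : V)
  (k : nat) (x : V) : 0 <= return_prob R nb o k x.
Proof.
elim: k x => //= k IH x; rewrite mulr_ge0// sumr_ge0// => j _.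
by case: ifP.
Qed.

(** The vertices of [g] occupy indices 0 to [size g - 1], so [m] ranges over the [k] indices that
    follow; for [g = [:: o]] the event is S <= k. *)
Definition returns (R : realType) (T V : Type) (X : R -> T -> V) (o : V) (k : nat)
    (g : seq V) : set T :=
  follows X g `&` [set w | exists m, [/\ (size g <= m < size g + k)%N,
    (jump_time X m w < +oo)%E & jump_chain X m w = o]].

Section orrw_return.
Variables (R : realType) (V : choiceType) (e : rel V) (o : V) (a : R).
Variables (d : measure_display) (T : measurableType d) (P : probability T R).
Variables (X : R -> T -> V) (XP : orrw e o a P X).
Variables (nb : V -> seq V) (nbE : forall x y, (y \in nb x) = e x y).
Hypothesis nb_uniq : forall x, uniq (nb x).
Hypothesis e_irr : irreflexive e.
Hypothesis a_gt0 : 0 < a.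

Let X_rc := orrw_right_continuous XP.
Local Notation pr A := (fine (P A)).
Local Notation mfollows := (follows_measurable XP).

Lemma returns0 (g : seq V) : returns X o 0 g = set0.
Proof.
apply/seteqP; split=> // w [_ [m []]]; rewrite addn0 => /andP[gm mg].
by move: (leq_ltn_trans gm mg); rewrite ltnn.
Qed.

Definition returns_next k (g : seq V) (j : V) :=
  if j == o then follows X (j :: g) else returns X o k (j :: g).

Lemma returns_next_sub k g j : returns_next k g j `<=` follows X (j :: g).
Proof. by rewrite /returns_next; case: ifP => // _ w []. Qed.

Lemma returnsS k (x : V) (p : seq V) : returns X o k.+1 (x :: p) =
  \bigcup_(j in [set` nb x]) returns_next k (x :: p) j.
Proof.
apply/seteqP; split=> [w [gw [m [/= /andP[gm mk] tm cm]]]|w [j jx]].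
  have tS : (jump_time X (size p).+1 w < +oo)%E.
    by apply: le_lt_trans tm; apply: jump_time_mono => //; exact: X_rc.
  have [j /= jx Fj] := follows_next XP nbE gw tS; exists j => //.
  (* Since [j] is not [o], the visit is not at the first of the [k.+1] indices, so it falls among
     the remaining [k]. *)
  rewrite /returns_next; case: eqP => // jo; split=> //.
  exists m; split=> //=; rewrite addSnnS mk andbT ltn_neqAle gm andbT.
  by apply/eqP => E; case: Fj => _ /= [cj _]; apply: jo; rewrite -cj -cm E.
move=> nj; have Fj := returns_next_sub nj; split; first exact: follows_cons_sub Fj.
move: nj; rewrite /returns_next; case: eqP => [jo _|_ [_ [m [/= /andP[gm mk] tm cm]]]].
  exists (size p).+1 => /=; rewrite leqnn/= addnS ltnS leq_addr; split=> //.
    by case: Fj.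
  by rewrite -jo; case: Fj => _ /= [].
by exists m; split=> //=; rewrite (ltnW gm)/= -addSnnS.
Qed.

Lemma returns_measurable k (g : seq V) : measurable (returns X o k g).
Proof.
elim: k g => [|k IH] [|x p]; rewrite ?returns0//.
  rewrite [X in measurable X](_ : _ = set0)//; apply/seteqP; split=> // w [[_ //]].
rewrite returnsS; apply: fin_bigcup_measurable => // j _.
by rewrite /returns_next; case: ifP => // _; exact: mfollows.
Qed.

Lemma returns_next_measurable k (g : seq V) j : measurable (returns_next k g j).
Proof.
by rewrite /returns_next; case: ifP => _; [exact: mfollows|exact: returns_measurable].
Qed.

Lemma pr_returnsS k (x : V) (p : seq V) : pr (returns X o k.+1 (x :: p)) =
  \sum_(j <- nb x) pr (returns_next k (x :: p) j).
Proof.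
rewrite returnsS pr_bigcup_seq//; last exact: returns_next_measurable.
move=> i j _ _ [w [/returns_next_sub Fi /returns_next_sub Fj]].
by apply: (@follows_trivIset _ _ _ _ X setT (x :: p) i j) => //; exists w.
Qed.

(** Each step has probability at most [1 / (a * deg)], against [1 / deg] for simple random walk, so
    [k] steps cost at most the factor [a ^- k]. *)
Lemma returns_upper k (x : V) (p : seq V) : a <= 1 ->
  pr (returns X o k (x :: p)) <=
  a ^- k * return_prob R nb o k x * pr (follows X (x :: p)).
Proof.
move=> a1; elim: k x p => [|k IH] x p; first by rewrite returns0 measure0 /= mulr0 mul0r.
rewrite pr_returnsS /= mulrCA -!mulrA mulr_suml !mulr_sumr.
rewrite big_seq [leRHS]big_seq; apply: ler_sum => j; rewrite nbE => xj.
have s0 : 0 < (size (nb x))%:R :> R.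
  by rewrite ltr0n; move: xj; rewrite -nbE; case: (nb x).
have Fj : pr (follows X (j :: x :: p)) <=
    (size (nb x))%:R^-1 * (a^-1 * pr (follows X (x :: p))).
  rewrite mulrA -invfM (mulrC _ a) [leRHS]mulrC ler_pdivlMr ?mulr_gt0//.
  by rewrite [leLHS]mulrC; exact: (follows_cons_le XP nbE nb_uniq e_irr a_gt0 p a1 xj).
have ak0 : 0 <= a ^- k by rewrite invr_ge0 exprn_ge0// ltW.
have ak1 : 1 <= a ^- k by rewrite invf_ge1 ?exprn_gt0// exprn_ile1// ltW.
rewrite /returns_next exprS invfM; case: ifP => _.
  (* A return at this step uses a single factor [a^-1]; the remaining [a ^- k >= 1] is slack. *)
  apply: (le_trans Fj); rewrite ler_wpM2l ?invr_ge0 ?ler0n// mul1r -mulrA.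
  rewrite ler_wpM2l ?invr_ge0 ?(ltW a_gt0)//.
  by rewrite -[leLHS]mul1r ler_wpM2r// pr_ge0.
apply: (le_trans (IH _ _)).
have r0 : 0 <= a ^- k * return_prob R nb o k j.
  by rewrite mulr_ge0// return_prob_ge0.
apply: (le_trans (ler_wpM2l r0 Fj)).
by rewrite le_eqVlt; apply/orP; left; apply/eqP; ring.
Qed.

(** Bounds [return_prob] by the return probability of an actual simple random walk, which is how
    transience comes to limit it. *)
Lemma returns_lower k (x : V) (p : seq V) : a = 1 ->
  return_prob R nb o k x * pr (follows X (x :: p)) <= pr (returns X o k (x :: p)).
Proof.
move=> a1; elim: k x p => [|k IH] x p; first by rewrite mul0r pr_ge0.
rewrite pr_returnsS /= -!mulrA mulr_suml !mulr_sumr.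
rewrite big_seq [leRHS]big_seq; apply: ler_sum => j; rewrite nbE => xj.
have s0 : 0 < (size (nb x))%:R :> R.
  by rewrite ltr0n; move: xj; rewrite -nbE; case: (nb x).
have Fj : (size (nb x))%:R^-1 * pr (follows X (x :: p)) <= pr (follows X (j :: x :: p)).
  by rewrite mulrC ler_pdivrMr// mulrC; exact: (follows_cons1 XP nbE nb_uniq e_irr a_gt0 p a1 xj).
rewrite mulrCA /returns_next; case: ifP => _; first by rewrite mul1r.
by apply: le_trans (IH _ _); rewrite ler_wpM2l// return_prob_ge0.
Qed.

Lemma follows_start : follows X [:: o] = setT.
Proof.
apply/seteqP; split=> // w _; split=> /=; first exact: ltry.
by rewrite /jump_chain /= (orrw_start XP).
Qed.

Lemma returns_return_time k w : returns X o k [:: o] w -> (return_time o X w < +oo)%E.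
Proof.
move=> [_ [m [/= /andP[m1 _] tm cm]]]; apply: (@le_lt_trans _ _ m%:R%:E); last exact: ltry.
by apply: ereal_inf_lbound; exists m.
Qed.

Lemma return_time_ltyE :
  [set w | (return_time o X w < +oo)%E] = \bigcup_k returns X o k [:: o].
Proof.
apply/seteqP; split=> [w /= /ereal_inf_lt[_ [m [m1 tm cm] _] _]|w [k _]].
  exists m => //; split; first by rewrite follows_start.
  by exists m; split=> //=; rewrite m1 add1n ltnS leqnn.
exact: returns_return_time.
Qed.

Lemma return_time_ge k w : ~ returns X o k [:: o] w -> (k.+1%:R%:E <= return_time o X w)%E.
Proof.
move=> H; apply: le_ereal_inf_tmp => _ [m [m1 tm cm] <-].
rewrite lee_fin ler_nat ltnNge; apply/negP => mk; apply: H.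
split; first by rewrite follows_start.
by exists m; split=> //=; rewrite m1 add1n ltnS mk.
Qed.

End orrw_return.

(** * Neighbour lists, the bound on the expectation, and the limit *)

Lemma bounded_degree_neighbours (V : choiceType) (e : rel V) : bounded_degree e ->
  exists nb : V -> seq V, (forall x, uniq (nb x)) /\ forall x y, (y \in nb x) = e x y.
Proof.
move=> [D eD].
have /choice[nb nbP] : forall x, exists s : seq V, [set y | e x y] = [set` s].
  by move=> x; apply/finite_seqP/(card_le_finite (eD x)); exact: finite_II.
(* Duplicates are removed so that [size (nb x)] is the degree. *)
exists (fun x => undup (nb x)); split=> [x|x y]; first exact: undup_uniq.
rewrite mem_undup; have /seteqP[enb nbe] := nbP x.
by apply/idP/idP => [/nbe|/enb].
Qed.

(* The integrand need not be measurable: the integral of a nonnegative function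
   is a supremum over the simple functions below it. *)
Lemma ge0_le_integral_set (R : realType) (d : measure_display) (T : measurableType d)
    (mu : {measure set T -> \bar R}) (f : T -> \bar R) (B : set T) (c : R) :
  measurable B -> 0 <= c -> (forall w, (0 <= f w)%E) ->
  (forall w, B w -> (c%:E <= f w)%E) -> (c%:E * mu B <= \int[mu]_w f w)%E.
Proof.
move=> mB c0 f0 cf; rewrite ge0_integralTE//; apply: ereal_sup_ubound => /=.
exists (scale_nnsfun (indic_nnsfun R mB) c0).
  move=> w /=; rewrite mindicE; case: (boolP (w \in B)) => [/set_mem/cf|_].
    by rewrite mulr1.
  by rewrite mulr0 f0.
by rewrite sintegralrM sintegral_indic.
Qed.

Theorem theorem1p3 (R : realType)
    (V : choiceType) (e : rel V) (o : V)
    (e_sym : symmetric e) (e_irr : irreflexive e)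
    (e_conn : connected_graph e) (e_bdd : bounded_degree e)
    (e_trans : transient R e o)
    (d : R -> measure_display) (T : forall a : R, measurableType (d a))
    (P : forall a : R, probability (T a) R)
    (X : forall a : R, R -> T a -> V)
    (X_orrw : forall a : R, 0 < a -> orrw e o a (P a) (X a)) :
  limf_esup (fun a : R => \int[P a]_w return_time o (X a) w)%E (1 : R)^'- = +oo%E.
Proof.
have [nb [nb_uniq nbE]] := bounded_degree_neighbours e_bdd.
have [d1 [T1 [P1 [X1 [X1P]]]]] := e_trans.
have mS : measurable [set w | (return_time o X1 w < +oo)%E].
  rewrite (return_time_ltyE X1P); apply: bigcup_measurable => k _.
  exact: (returns_measurable X1P nbE).
rewrite -(pr_fineK P1 mS) lte_fin; set q := fine _ => q1.
have q0 : 0 <= q by exact: pr_ge0.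
(* Transience enters here: the bound [q < 1] is uniform in [k]. *)
have rq k : return_prob R nb o k o <= q.
  have := returns_lower X1P nbE nb_uniq e_irr ltr01 k o [::] erefl.
  rewrite (follows_start X1P) probability_setT mulr1 => /le_trans; apply.
  apply: pr_le => //; first exact: (returns_measurable X1P nbE).
  exact: returns_return_time.
(* Off the event S <= k the return time is at least [k.+1], and [returns_upper] bounds the
   probability of that event. *)
have lower a k : 0 < a -> a <= 1 ->
    ((k.+1%:R * (1 - a ^- k * q))%:E <= \int[P a]_w return_time o (X a) w)%E.
  move=> a0 a1; have XP := X_orrw a a0.
  have mk := returns_measurable XP nbE k [:: o].
  apply: (@le_trans _ _ (k.+1%:R%:E * P a (~` returns (X a) o k [:: o]))%E); last first.
    apply: ge0_le_integral_set => //; first exact: measurableC.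
      by move=> w; apply: le_ereal_inf_tmp => _ [n _ <-]; rewrite lee_fin.
    by move=> w; exact: (return_time_ge XP).
  rewrite probability_setC// -pr_fineK// -EFinB -EFinM lee_fin ler_wpM2l// lerB//.
  have := returns_upper XP nbE nb_uniq e_irr a0 k o [::] a1.
  rewrite (follows_start XP) probability_setT mulr1 => /le_trans; apply.
  by rewrite ler_wpM2l// invr_ge0 exprn_ge0// ltW.
(* The upper limit is an infimum, over left neighbourhoods [U] of 1, of suprema on [U]; for each
   [M > 0] one point of [U] with expectation at least [M] suffices. *)
apply/eqP; rewrite -leye_eq /limf_esup; apply: le_ereal_inf_tmp => _ [U FU <-].
rewrite leye_eq; apply/eqP/eqyP => M M0.
(* [k] makes [k.+1 * (1 - q) / 2] at least [M]; the other half of [1 - q] is given up to absorb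
   [a ^- k]. *)
pose k := Num.truncn (M * 2 / (1 - q)).
have Mk : M <= k.+1%:R * ((1 - q) / 2).
  rewrite mulrA ler_pdivlMr// -ler_pdivrMr ?subr_gt0// ltW// truncnS_gt//.
have cvk : (fun a : R => a ^+ k) @ (1 : R)^'- --> (1 : R).
  by rewrite -[X in _ --> X](expr1n _ k); apply: cvg_at_left_filter; exact: exprn_continuous.
(* The threshold is below 1 since [q < 1], and beyond it [a ^- k * q <= (1 + q) / 2], that is,
   [1 - a ^- k * q >= (1 - q) / 2]. *)
have [a [Ua a0 a1 ak]] : exists a, [/\ U a, 0 < a, a <= 1 & 2 * q / (1 + q) < a ^+ k].
  apply: (@filter_ex _ (1 : R)^'-); near=> a; split.
  - by near: a.
  - by near: a; apply: nbhs_left_gt.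
  - by near: a; exact: nbhs_left_le.
  - by near: a; apply: (cvgr_gt 1 cvk); rewrite ltr_pdivrMr; lra.
apply: le_trans (ereal_sup_ubound _); last by exists a.
apply: le_trans (lower a k a0 a1); rewrite lee_fin (le_trans Mk)// ler_wpM2l//.
have ak0 : 0 < a ^+ k by rewrite exprn_gt0.
have -> : (1 - q) / 2 = 1 - (1 + q) / 2 by field.
rewrite lerB// mulrC ler_pdivrMr//.
move: ak; rewrite ltr_pdivrMr ?ltr_wpDr//.
by rewrite mulrAC ler_pdivlMr// [q * 2]mulrC [_ * a ^+ k]mulrC => /ltW.
Unshelve. all: by end_near. Qed.
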